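(* Let $\sigma(x)=\sin(x)$. Then for all $\mu_1\in\mathbb R$ and all positive semidefinite $\begin{pmatrix}\nu_{11}&\nu_{12}\\ \nu_{12}&\nu_{22}\end{pmatrix}$, $$L_\sigma(\mu_1;\nu_{11},\nu_{22},\nu_{12})=\nu_{12}\,e^{-\nu_{11}/2}\cos(\mu_1).$$
   Context: $L_\sigma(\mu_1;\nu_{11},\nu_{22},\nu_{12}):=\operatorname{Cov}(\sigma(X_1),X_2)$ where $(X_1,X_2)$ is jointly normal with covariance matrix $\begin{pmatrix}\nu_{11}&\nu_{12}\\ \nu_{12}&\nu_{22}\end{pmatrix}$, $\mathbb E X_1=\mu_1$, and $\mathbb E X_2$ arbitrary (the value does not depend on it). *)

(* Defs.v *)
From HB Require Import structures.
From mathcomp Require Import all_boot all_order all_algebra.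
From mathcomp Require Import all_classical all_reals all_analysis.

Set Implicit Arguments.
Unset Strict Implicit.
Unset Printing Implicit Defensive.

Import Order.TTheory GRing.Theory Num.Theory.
Import numFieldNormedType.Exports.

Local Open Scope classical_set_scope.
Local Open Scope ring_scope.

Definition covmx2 (R : realType) (nu11 nu22 nu12 : R) : 'M[R]_2 :=
  \matrix_(i < 2, j < 2)
    (if i == j then (if i == ord0 then nu11 else nu22) else nu12).

Definition psdmx (R : realType) (n : nat) (A : 'M[R]_n) : Prop :=
  A^T = A /\ forall x : 'cV[R]_n, 0 <= (x^T *m A *m x) ord0 ord0.

(* The normal law with mean m and standard deviation s. The degenerate case
   s = 0 must be the Dirac mass at m, whereas the library's [normal_prob m 0]
   is the uniform law on [0, 1]. *)
Definition normal_law (R : realType) (m s : R) (A : set R) : \bar R :=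
  if s == 0 then \d_m A else normal_prob m s A.

Definition normal_rv d (T : measurableType d) (R : realType)
    (P : probability T R) (X : T -> R) : Prop :=
  exists m s : R, 0 <= s /\
    forall A : set R, measurable A -> P (X @^-1` A) = normal_law m s A.

(* Joint normality: every linear combination is normal, possibly degenerate, so
   that singular covariance matrices are allowed. *)
Definition jointly_normal d (T : measurableType d) (R : realType)
    (P : probability T R) (X1 X2 : {RV P >-> R}) : Prop :=
  forall a b : R, normal_rv P (fun w => a * X1 w + b * X2 w).

(* The mean of X2 is left free. *)
Definition normal_pair d (T : measurableType d) (R : realType)
    (P : probability T R) (mu1 nu11 nu22 nu12 : R) (X1 X2 : {RV P >-> R}) : Prop :=
  [/\ jointly_normal X1 X2,
      'E_P[X1] = mu1%:E,
      'V_P[X1] = nu11%:E,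
      'V_P[X2] = nu22%:E &
      covariance P X1 X2 = nu12%:E]%E.

(* l is the value of Cov(sigma(X1), X2): such pairs exist, and all of them, on
   any probability space and for any mean of X2, give l. *)
Definition is_Lcov (R : realType) (sigma : R -> R) (mu1 nu11 nu22 nu12 : R)
    (l : \bar R) : Prop :=
  (exists (d : measure_display) (T : measurableType d) (P : probability T R)
     (X1 X2 : {RV P >-> R}), normal_pair mu1 nu11 nu22 nu12 X1 X2) /\
  (forall (d : measure_display) (T : measurableType d) (P : probability T R)
     (X1 X2 : {RV P >-> R}), normal_pair mu1 nu11 nu22 nu12 X1 X2 ->
     covariance P (sigma \o X1) X2 = l).

(* [+oo] is a junk value when no l satisfies [is_Lcov]; in particular an equation
   [Lcov ... = r%:E] with r real entails [is_Lcov ... r%:E]. *)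
Definition Lcov (R : realType) (sigma : R -> R) (mu1 nu11 nu22 nu12 : R) : \bar R :=
  xget +oo%E [set l | is_Lcov sigma mu1 nu11 nu22 nu12 l].

(* Main.v *)
(* Every linear combination X1 + t X2 of a jointly normal pair is normal, and its
   law is fixed by its mean m(t) and variance v(t), so the value at 1 of the
   characteristic function gives E cos(X1 + t X2) = exp(- v(t) / 2) cos m(t).
   Differentiating at t = 0 yields E[X2 sin X1], hence the covariance. The
   characteristic function itself solves C'(t) = - t C(t) by Stein's identity,
   which is the infinitesimal form of the density formula for a shifted standard
   normal law. Pairs with a prescribed positive semidefinite covariance matrix are
   linear images of two independent standard normal variables; that such images
   are jointly normal is the convolution formula for Gaussian densities. *)
Require Import Defs.
From HB Require Import structures.
From mathcomp Require Import all_boot all_order all_algebra.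
From mathcomp Require Import ring lra.
From mathcomp Require Import all_classical all_reals all_analysis measurable_realfun.

Import Order.TTheory GRing.Theory Num.Theory.
Import numFieldNormedType.Exports.

Local Open Scope classical_set_scope.
Local Open Scope ring_scope.

(** * Affine images of Lebesgue measure and of normal laws *)

Definition image_measure {d d'} {T1 : measurableType d} {T2 : measurableType d'}
    {R : realFieldType} (mu : {measure set T1 -> \bar R}) {f : T1 -> T2}
    (mf : measurable_fun [set: T1] f) : {measure set T2 -> \bar R} :=
  measure_function_pushforward__canonical__measure_function_Measure mu mf.

Lemma measurable_affine {R : realType} (m s : R) :
  measurable_fun [set: R] (fun z : R => m + s * z).
Proof. by apply: measurable_funD => //; apply: measurable_funM. Qed.

Lemma preimage_affine_itvoc {R : realType} (m s a b : R) : 0 < s ->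
  (fun z : R => m + s * z) @^-1` `]a, b] = `](a - m) / s, (b - m) / s]%classic.
Proof.
move=> s0; apply/seteqP; split => z /=; rewrite !in_itv/= ltr_pdivrMr// ler_pdivlMr//.
  by move=> /andP[? ?]; apply/andP; split; lra.
by move=> /andP[? ?]; apply/andP; split; lra.
Qed.

Lemma preimage_affine_itvoc_neg {R : realType} (m s a b : R) : s < 0 ->
  (fun z : R => m + s * z) @^-1` `]a, b] = `[(b - m) / s, (a - m) / s[%classic.
Proof.
move=> s0; apply/seteqP; split => z /=; rewrite !in_itv/= ltr_ndivlMr// ler_ndivrMr//.
  by move=> /andP[? ?]; apply/andP; split; lra.
by move=> /andP[? ?]; apply/andP; split; lra.
Qed.

(** By uniqueness of Lebesgue measure it suffices to compare both sides on intervals []a, b]]. For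
    [s < 0] the preimage is half-open on the other side, which does not change its length. *)
Lemma lebesgue_measure_affine {R : realType} (m s : R) (A : set R) : s != 0 ->
  measurable A ->
  lebesgue_measure A =
  (`|s|%:E * lebesgue_measure ((fun z : R => (m + s * z)%R) @^-1` A))%E.
Proof.
move=> s0 mA.
pose f := fun z : measurableTypeR R => (m + s * z : measurableTypeR R).
have mf : measurable_fun [set: measurableTypeR R] f by exact: measurable_affine.
pose nu : {measure set (measurableTypeR R) -> \bar R} :=
  mscale (NngNum (normr_ge0 s)) (image_measure lebesgue_measure mf).
refine (lebesgue_measure_unique (mu := nu) _ mA) => _ [[a b] _ <-] /=.
rewrite /nu /=.
rewrite /mscale/= /pushforward.
have [sn|sp|s00] := ltgtP s 0; last by rewrite s00 eqxx in s0.
- rewrite preimage_affine_itvoc_neg// !lebesgue_measure_itv/= !lte_fin.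
  rewrite ltr_nM2r ?invr_lt0// ltrD2r; case: ifPn => _; last by rewrite mule0.
  rewrite -!EFinB -EFinM ltr0_norm//; congr EFin; field; exact: s0.
- rewrite preimage_affine_itvoc// !lebesgue_measure_itv/= !lte_fin.
  rewrite ltr_pM2r ?invr_gt0// ltrD2r; case: ifPn => _; last by rewrite mule0.
  rewrite -!EFinB -EFinM gtr0_norm//; congr EFin; field; exact: s0.
Qed.

(** The Radon-Nikodym derivative agrees almost everywhere with [normal_pdf], because both have
    integral [normal_prob m s E] over every measurable [E]. *)
Lemma ge0_integral_normal_prob {R : realType} (m s : R) (f : R -> \bar R) :
  measurable_fun [set: R] f -> (forall x, 0 <= f x)%E ->
  (\int[normal_prob m s]_x f x =
   \int[lebesgue_measure]_x (f x * (normal_pdf m s x)%:E))%E.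
Proof.
move=> mf f0; have dom := normal_prob_dominates m s.
rewrite -(Radon_Nikodym_SigmaFinite.change_of_variables dom)//.
have mpdf : measurable_fun [set: R] (fun x => (normal_pdf m s x)%:E).
  by apply/measurable_EFinP; exact: measurable_normal_pdf.
have iRN := Radon_Nikodym_SigmaFinite.f_integrable dom.
apply: ae_eq_integral => //.
- apply: emeasurable_funM => //; exact: measurable_int iRN.
- exact: emeasurable_funM.
- apply: ae_eqe_mul2l; apply: integral_ae_eq => // E _ mE.
  by rewrite -Radon_Nikodym_SigmaFinite.f_integral.
Qed.

(** Change of variables in the density integral: the Jacobian [|s|] cancels the factor [|s|] in the
    denominator of [normal_peak s]. Negative [s] is allowed, and [s = -1] later yields the symmetry
    of the standard law. *)
Lemma normal_prob_affine {R : realType} (m s : R) (A : set R) : s != 0 ->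
  measurable A ->
  normal_prob m s A = normal_prob 0 1 ((fun z : R => m + s * z) @^-1` A).
Proof.
move=> s0 mA; rewrite /normal_prob.
pose f := fun z : measurableTypeR R => (m + s * z : measurableTypeR R).
have mf : measurable_fun [set: measurableTypeR R] f by exact: measurable_affine.
have mpdf B m' s' : measurable_fun B (fun x : R => (normal_pdf m' s' x)%:E).
  apply: measurable_funTS.
  by apply/measurable_EFinP; exact: measurable_normal_pdf.
transitivity (\int[mscale (NngNum (normr_ge0 s)) (image_measure lebesgue_measure mf)]_(x in A) (normal_pdf m s x)%:E)%E.
  apply: eq_measure_integral => B mB _.
  by rewrite /mscale/= /pushforward; exact: lebesgue_measure_affine.
have mfA : measurable (f @^-1` A) by rewrite -[X in measurable X]setTI; exact: mf.
have pdf0 B x : B x -> (0 <= (normal_pdf m s x)%:E)%E by rewrite lee_fin normal_pdf_ge0.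
rewrite ge0_integral_mscale//=; [|exact: mpdf|by move=> x /pdf0].
rewrite ge0_integral_pushforward//=; [|exact: mpdf|by move=> x; rewrite inE => /pdf0].
rewrite -ge0_integralZl//=; [| |by move=> x _; rewrite lee_fin normal_pdf_ge0]; last first.
  apply: measurable_funTS.
  exact: (measurableT_comp (f := fun x : measurableTypeR R => (normal_pdf m s x)%:E) (mpdf _ _ _) mf).
apply: eq_integral => x _; rewrite -EFinM; congr EFin.
rewrite !normal_pdfE ?oner_neq0// /normal_peak /normal_fun /f mulrA; congr (_ * expR _).
  rewrite -!mulrnAr sqrtrM ?sqr_ge0// sqrtr_sqr expr1n mul1r invfM mulrA divff ?mul1r//.
  by rewrite normr_eq0.
rewrite expr1n subr0 addrC addKr exprMn; field; exact: s0.
Qed.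
Arguments ge0_integral_normal_prob {R} m s {f}.

Local Notation std := (normal_prob 0 1).

Lemma ge0_integral_affine_normal_prob {R : realType} (m s : R) (f : R -> \bar R) :
  s != 0 -> measurable_fun [set: R] f -> (forall x, 0 <= f x)%E ->
  (\int[normal_prob m s]_x f x = \int[std]_z f (m + s * z)%R)%E.
Proof.
move=> s0 mf f0.
have ma : measurable_fun [set: measurableTypeR R]
  (fun z => m + s * z : measurableTypeR R) by exact: measurable_affine.
transitivity (\int[image_measure std ma]_x f x)%E.
  by apply: eq_measure_integral => A mA _; exact: normal_prob_affine.
by rewrite ge0_integral_pushforward.
Qed.

(** * Shifts of the standard normal law and Stein's identity *)

Lemma normal_pdf_shift {R : realType} (h z : R) :
  normal_pdf h 1 z = expR (h * z - h ^+ 2 / 2) * normal_pdf 0 1 z.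
Proof.
rewrite !normal_pdfE ?oner_neq0// mulrCA; congr (_ * _).
by rewrite -expRD; congr expR; field.
Qed.

(** Both sides equal the integral of [f] against [normal_prob h 1], seen once as an affine image of
    the standard law and once through the ratio of the two densities. *)
Lemma ge0_integral_std_shift {R : realType} (h : R) (f : R -> \bar R) :
  measurable_fun [set: R] f -> (forall x, 0 <= f x)%E ->
  (\int[std]_z f (z + h)%R =
   \int[std]_z (f z * (expR (h * z - h ^+ 2 / 2))%:E))%E.
Proof.
move=> mf f0.
have me : measurable_fun [set: R] (fun z : R => (expR (h * z - h ^+ 2 / 2))%:E).
  apply/measurable_EFinP/measurableT_comp => //.
  by apply: measurable_funB => //; exact: measurable_funM.
transitivity (\int[normal_prob h 1]_x f x)%E.
  rewrite (ge0_integral_affine_normal_prob h 1 f (oner_neq0 R) mf f0).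
  by apply: eq_integral => z _; rewrite mul1r addrC.
rewrite (ge0_integral_normal_prob h 1 mf f0).
rewrite (ge0_integral_normal_prob 0 1 (emeasurable_funM mf me)); last first.
  by move=> x; rewrite mule_ge0// lee_fin expR_ge0.
by apply: eq_integral => z _; rewrite normal_pdf_shift EFinM muleA.
Qed.

(** Multiplication by a positive exponential commutes with taking positive and negative parts, so
    the nonnegative case applies to each part and no integrability is involved. *)
Lemma integral_std_shift {R : realType} (h : R) (f : R -> R) :
  measurable_fun [set: R] f ->
  \int[std]_z f (z + h) = \int[std]_z (f z * expR (h * z - h ^+ 2 / 2)).
Proof.
move=> mf; congr fine; rewrite [LHS]integralE [RHS]integralE.
have mF : measurable_fun [set: R] (EFin \o f) by exact/measurable_EFinP.
congr (_ - _)%E.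
- transitivity (\int[std]_z (EFin \o f)^\+ (z + h)%R)%E.
  by apply: eq_integral => z _; rewrite ?funepos.unlock ?funeneg.unlock.
  rewrite (ge0_integral_std_shift h); [|exact: measurable_funepos|by []].
  apply: eq_integral => z _; rewrite !funepos.unlock/=.
  by rewrite -!EFin_max -EFinM maxr_pMl ?expR_ge0// mul0r.
- transitivity (\int[std]_z (EFin \o f)^\- (z + h)%R)%E.
  by apply: eq_integral => z _; rewrite ?funepos.unlock ?funeneg.unlock.
  rewrite (ge0_integral_std_shift h); [|exact: measurable_funeneg|by []].
  apply: eq_integral => z _; rewrite !funeneg.unlock/=.
  by rewrite -!EFin_max -EFinM maxr_pMl ?expR_ge0// mul0r mulNr.
Qed.

(** The shift formula for the constant 1 says that [expR (a * z - a ^+ 2 / 2)] has integral 1, which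
    gives the moment generating function. *)
Lemma integrable_std_expR {R : realType} (a : R) :
  (std : probability _ R).-integrable [set: R] (fun z : R => (expR (a * z))%:E).
Proof.
have me : measurable_fun [set: R] (fun z : R => expR (a * z)).
  by apply: measurableT_comp => //; exact: measurable_funM.
apply/integrableP; split; first exact/measurable_EFinP.
have : (\int[std]_z (cst 1 : R -> \bar R) (z + a)%R = 1)%E.
  by rewrite integral_cst//= mul1e; exact: integral_normal_pdf.
rewrite (ge0_integral_std_shift a)// => eq1.
have me' : measurable_fun [set: R] (fun z : R => (expR (a * z - a ^+ 2 / 2))%:E).
  apply/measurable_EFinP/measurableT_comp => //.
  by apply: measurable_funB => //; exact: measurable_funM.
suff -> : (\int[std]_z `|(expR (a * z))%:E| = (expR (a ^+ 2 / 2))%:E)%E by rewrite ltry.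
rewrite -[RHS]mule1 -eq1 -ge0_integralZl//; last 2 first.
- exact: emeasurable_funM.
- by move=> z _; rewrite /= mul1e lee_fin expR_ge0.
apply: eq_integral => z _; rewrite /= mul1e -EFinM -expRD ger0_norm ?expR_ge0//.
by congr (expR _)%:E; ring.
Qed.

(** [expR (a * |z|)] is one of [expR (a * z)] and [expR (- a * z)], hence at most their sum. *)
Lemma le_expR_integrable_std {R : realType} (a : R) (f : R -> R) :
  measurable_fun [set: R] f -> (forall z, `|f z| <= expR (a * `|z|)) ->
  (std : probability _ R).-integrable [set: R] (EFin \o f).
Proof.
move=> mf fa.
have := integrableD measurableT (integrable_std_expR a) (integrable_std_expR (- a)).
apply: le_integrable => //; first exact/measurable_EFinP.
move=> z _ /=; rewrite lee_fin (le_trans (fa z))//.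
rewrite (ger0_norm (addr_ge0 (expR_ge0 _) (expR_ge0 _))).
have [z0|z0] := leP 0 z.
  by rewrite ger0_norm// lerDl expR_ge0.
by rewrite ltr0_norm// mulrN mulNr lerDr expR_ge0.
Qed.

(* Stein's identity without differentiating [f]: the shift is moved to the density. *)
Lemma cvg_std_shift {R : realType} (f : R -> R) :
  measurable_fun [set: R] f -> (forall z, `|f z| <= expR `|z|) ->
  h^-1 *: (\int[std]_z f (z + h) - \int[std]_z f z) @[h --> (0:R)^'] -->
  \int[std]_z (f z * z).
Proof.
move=> mf fe.
pose g (h z : R) : R := f z * expR (h * z - h ^+ 2 / 2).
pose F h : R := \int[std]_z (g h z).
have dg (h z : R) : is_derive h 1 (g ^~ z) (g h z * (z - h)).
  apply: is_derive_eq.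
  by rewrite /g !scaler0 !scaler1 /GRing.scale/=; field.
have d1g h z : partial1of2 g h z = g h z * (z - h).
  by rewrite partial1of2E; apply: derive_val.
have mg h : measurable_fun [set: R] (g h).
  apply: measurable_funM => //; apply: measurableT_comp => //.
  by apply: measurable_funB => //; exact: measurable_funM.
(* One [|z|] bounds [f], the other bounds the exponent [h * z - h ^+ 2 / 2] uniformly in
   [|h| < 1]. *)
have gub (h z : R) : h \in `]-1, 1[ -> `|g h z| <= expR (2 * `|z|).
  rewrite in_itv/= => /andP[h1 h2].
  rewrite normrM (ger0_norm (expR_ge0 _)).
  have -> : 2 * `|z| = `|z| + `|z| by ring.
  rewrite (expRD `|z|).
  rewrite ler_pM ?expR_ge0// ler_expR.
  have hz : h * z <= `|h| * `|z| by rewrite -normrM ler_norm.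
  have hz1 : `|h| * `|z| <= `|z| by rewrite ler_piMl// ler_norml; lra.
  have h2_ge0 := sqr_ge0 h. lra.
have F0 : F 0 = \int[std]_z f z.
  by apply: eq_Rintegral => z _; rewrite /g mul0r expr0n/= mul0r subr0 expR0 mulr1.
have -> : (fun h : R => h^-1 *: (\int[std]_z f (z + h) - \int[std]_z f z)) =
    (fun h => h^-1 *: (F (h + 0) - F 0)).
  by apply/funext => h; rewrite addr0 F0 integral_std_shift.
have -> : \int[std]_z (f z * z) = \int[std]_z partial1of2 g 0 z.
  apply: eq_Rintegral => z _.
  by rewrite d1g /g mul0r expr0n/= mul0r !subr0 expR0 mulr1.
(* The third [|z|] in the dominating function absorbs the factor [z - h] of the derivative, since
   [|z - h| <= 1 + |z| <= expR |z|]. *)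
apply: (@cvg_differentiation_under_integral _ _ _ std g setT measurableT 0 (-1) 1
  _ _ _ (fun z => expR (3 * `|z|))).
- by rewrite /= in_itv/= ltrN10 ltr01.
- move=> h /= hI; apply: (le_expR_integrable_std 2) => // z; exact: gub.
- by move=> h z _ _; apply: ex_derive.
- by move=> z; exact: expR_ge0.
- apply: (le_expR_integrable_std 3) => [|z]; last by rewrite ger0_norm ?expR_ge0.
  by apply: measurableT_comp => //; apply: measurable_funM => //; exact: measurableT_comp.
- move=> h z /= hI _; rewrite d1g normrM.
  have -> : 3 * `|z| = 2 * `|z| + `|z| by ring.
  rewrite expRD ler_pM ?gub// (le_trans _ (expR_ge1Dx _))//.
  rewrite (le_trans (ler_normB _ _))// addrC lerD2r.
  by move: hI; rewrite in_itv/= ler_norml => /andP[? ?]; lra.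
Qed.

(** * Transfer of integrals between equal laws, and symmetry of the standard law *)

(** The two image measures on the line coincide on measurable sets; general [f] is split into its
    positive and negative parts. *)
Lemma integral_same_law {d1 d2 : measure_display} {T1 : measurableType d1}
    {T2 : measurableType d2} {R : realType} (P1 : {measure set T1 -> \bar R})
    (P2 : {measure set T2 -> \bar R}) (X1 : T1 -> R) (X2 : T2 -> R) (f : R -> R) :
  measurable_fun [set: T1] X1 -> measurable_fun [set: T2] X2 ->
  (forall A, measurable A -> P1 (X1 @^-1` A) = P2 (X2 @^-1` A)) ->
  measurable_fun [set: R] f ->
  (\int[P1]_w (f (X1 w))%:E = \int[P2]_w (f (X2 w))%:E)%E.
Proof.
move=> m1 m2 eqlaw mf.
have mF : measurable_fun [set: R] (EFin \o f) by exact/measurable_EFinP.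
have ge0_eq (g : R -> \bar R) : measurable_fun [set: R] g -> (forall x, 0 <= g x)%E ->
    (\int[P1]_w g (X1 w) = \int[P2]_w g (X2 w))%E.
  move=> mg g0.
  have E1 := ge0_integral_pushforward m1 P1 measurableT mg (in1W g0).
  have E2 := ge0_integral_pushforward m2 P2 measurableT mg (in1W g0).
  rewrite -[LHS]E1 -[RHS]E2.
  by apply: (@eq_measure_integral _ _ _ _ (image_measure P2 m2) (image_measure P1 m1))
    => A mA _; exact: eqlaw.
rewrite [LHS]integralE [RHS]integralE; congr (_ - _)%E.
- transitivity (\int[P1]_w (EFin \o f)^\+ (X1 w))%E.
    by apply: eq_integral => w _; rewrite !funepos.unlock.
  rewrite ge0_eq//; last exact: measurable_funepos.
  by apply: eq_integral => w _; rewrite !funepos.unlock.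
- transitivity (\int[P1]_w (EFin \o f)^\- (X1 w))%E.
    by apply: eq_integral => w _; rewrite !funeneg.unlock.
  rewrite ge0_eq//; last exact: measurable_funeneg.
  by apply: eq_integral => w _; rewrite !funeneg.unlock.
Qed.

(** The Dirac case is the image of the standard law under a constant map, so this form spares later
    integrals the case distinction on [s]. *)
Lemma normal_law_affine {R : realType} (m s : R) (A : set R) : measurable A ->
  normal_law m s A = std ((fun z : R => m + s * z) @^-1` A).
Proof.
move=> mA; rewrite /normal_law; case: ifPn => [/eqP ->|s0]; last exact: normal_prob_affine.
have -> : (fun z : R => m + 0 * z) = cst m by apply/funext => z /=; rewrite mul0r addr0.
rewrite preimage_cst diracE; case: ifPn => _ /=; last by rewrite measure0.
by rewrite probability_setT.
Qed.

(** The density involves the deviation only through its square, so [-1] and [1] give the same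
    law. *)
Lemma std_opp {R : realType} (A : set R) : measurable A ->
  std (-%R @^-1` A) = std A.
Proof.
move=> mA; have := normal_prob_affine 0 (-1) A.
rewrite oppr_eq0 oner_neq0 => /(_ isT mA).
have -> : (fun z : R => 0 + -1 * z) = -%R by apply/funext => z; rewrite add0r mulN1r.
move=> <-; apply: eq_integral => x _.
by rewrite !normal_pdfE ?oppr_eq0 ?oner_neq0// /normal_peak /normal_fun sqrrN.
Qed.

Lemma integral_std_odd {R : realType} (f : R -> R) :
  measurable_fun [set: R] f -> (forall z, f (- z) = - f z) ->
  (forall z, `|f z| <= expR `|z|) -> \int[std]_z f z = 0.
Proof.
move=> mf fN fe.
have fi : (std : probability _ R).-integrable [set: R] (EFin \o f).
  by apply: (le_expR_integrable_std 1) => // z; rewrite mul1r.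
have : \int[std]_z f (- z) = \int[std]_z f z.
  congr fine; apply: (integral_same_law std std (-%R : R -> R) id f) => //.
  by move=> A mA; exact: std_opp.
under eq_Rintegral do rewrite fN -mulN1r.
rewrite RintegralZl//; lra.
Qed.

(** * Moments and trigonometric integrals of the standard normal law *)

Lemma norm_le_expR {R : realType} (z : R) : `|z| <= expR `|z|.
Proof. by rewrite (le_trans _ (expR_ge1Dx _))// lerDr. Qed.

Lemma le1_expR_norm {R : realType} (x z : R) : `|x| <= 1 -> `|x| <= expR `|z|.
Proof. by move=> /le_trans; apply; rewrite (le_trans _ (expR_ge1Dx _))// lerDl. Qed.

Lemma norm_sin_le1 {R : realType} (x : R) : `|sin x| <= 1.
Proof. by rewrite ler_norml sin_geN1 sin_le1. Qed.

Lemma norm_cos_le1 {R : realType} (x : R) : `|cos x| <= 1.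
Proof. by rewrite ler_norml cos_geN1 cos_le1. Qed.

Lemma measurable_sin {R : realType} : measurable_fun [set: R] (@sin R).
Proof. by apply: continuous_measurable_fun; exact: continuous_sin. Qed.

Lemma measurable_cos {R : realType} : measurable_fun [set: R] (@cos R).
Proof. by apply: continuous_measurable_fun; exact: continuous_cos. Qed.

Lemma integrable_std_id {R : realType} :
  (std : probability _ R).-integrable [set: R] (EFin \o id).
Proof.
by apply: (le_expR_integrable_std 1) => // z; rewrite mul1r norm_le_expR.
Qed.

Lemma integrable_std_sqr {R : realType} :
  (std : probability _ R).-integrable [set: R] (EFin \o (fun z => z * z)).
Proof.
apply: (le_expR_integrable_std 2) => [|z]; first exact: measurable_funM.
by rewrite normrM mulrDl mul1r expRD ler_pM ?norm_le_expR.
Qed.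

Lemma integral_std_id {R : realType} : \int[std]_z (z : R) = 0.
Proof. by apply: (integral_std_odd id) => // z; exact: norm_le_expR. Qed.

Lemma Rintegral_std_cst {R : realType} (c : R) : \int[std]_z c = c.
Proof. by rewrite Rintegral_cst// /= probability_setT mulr1. Qed.

(** Stein's identity for the identity function, whose averaged difference quotient is constantly
    1. *)
Lemma integral_std_sqr {R : realType} : \int[std]_z ((z : R) * z) = 1.
Proof.
apply: cvg_unique (cvg_std_shift id _ norm_le_expR) _ => //.
apply: cvg_near_cst; near=> h.
have h0 : h != 0 by near: h; exact: nbhs_dnbhs_neq.
rewrite RintegralD//; [|exact: integrable_std_id|exact: finite_measure_integrable_cst].
by rewrite Rintegral_std_cst addrAC subrr add0r /GRing.scale/= mulVf.
Unshelve. all: by end_near. Qed.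

(** Puts a derivative in the form of the limits of averaged quotients, so that two evaluations of
    one limit can be compared. *)
Lemma is_derive_cvg_quotient {R : realType} (f : R -> R) (x l : R) :
  is_derive x 1 f l -> h^-1 *: (f (h + x) - f x) @[h --> (0:R)^'] --> l.
Proof.
case=> df <-; have := df; rewrite /derivable => /cvg_ex[l'].
rewrite /derive; under eq_fun do rewrite scaler1.
by move=> /[dup] cl /cvg_lim ->.
Qed.

Lemma integrable_std_bounded {R : realType} (f : R -> R) :
  measurable_fun [set: R] f -> (forall z, `|f z| <= 1) ->
  (std : probability _ R).-integrable [set: R] (EFin \o f).
Proof.
by move=> mf f1; apply: (le_expR_integrable_std 1) => // z; rewrite mul1r le1_expR_norm.
Qed.

Lemma measurable_sinZ {R : realType} (t : R) : measurable_fun [set: R] (fun z : R => sin (t * z)).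
Proof. apply: (measurableT_comp measurable_sin); exact: measurable_funM. Qed.

Lemma measurable_cosZ {R : realType} (t : R) : measurable_fun [set: R] (fun z : R => cos (t * z)).
Proof. apply: (measurableT_comp measurable_cos); exact: measurable_funM. Qed.

Lemma integrable_std_sin {R : realType} (t : R) :
  (std : probability _ R).-integrable [set: R] (EFin \o (fun z => sin (t * z))).
Proof.
by apply: integrable_std_bounded => [|z]; [exact: measurable_sinZ|exact: norm_sin_le1].
Qed.

Lemma integrable_std_cos {R : realType} (t : R) :
  (std : probability _ R).-integrable [set: R] (EFin \o (fun z => cos (t * z))).
Proof.
by apply: integrable_std_bounded => [|z]; [exact: measurable_cosZ|exact: norm_cos_le1].
Qed.

Lemma integral_std_sin {R : realType} (t : R) : \int[std]_z sin (t * z) = 0.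
Proof.
apply: integral_std_odd => [|z|z]; first exact: measurable_sinZ.
  by rewrite mulrN sinN.
by rewrite le1_expR_norm ?norm_sin_le1.
Qed.

Lemma integral_std_sin_shift {R : realType} (t b : R) :
  \int[std]_z sin (t * z + b) = sin b * \int[std]_z cos (t * z).
Proof.
have E z : sin (t * z + b) = cos b * sin (t * z) + sin b * cos (t * z).
  by rewrite sinD; ring.
under eq_Rintegral do rewrite E.
rewrite RintegralD//=; last 2 first.
- exact: (integrableZl _ _ (integrable_std_sin t)).
- exact: (integrableZl _ _ (integrable_std_cos t)).
rewrite !RintegralZl//; [|exact: integrable_std_cos|exact: integrable_std_sin].
by rewrite integral_std_sin mulr0 add0r.
Qed.

Lemma integral_std_cos_shift {R : realType} (t b : R) :
  \int[std]_z cos (t * z + b) = cos b * \int[std]_z cos (t * z).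
Proof.
have E z : cos (t * z + b) = cos b * cos (t * z) + - sin b * sin (t * z).
  by rewrite cosD; ring.
under eq_Rintegral do rewrite E.
rewrite RintegralD//=; last 2 first.
- exact: (integrableZl _ _ (integrable_std_cos t)).
- exact: (integrableZl _ _ (integrable_std_sin t)).
rewrite !RintegralZl//; [|exact: integrable_std_sin|exact: integrable_std_cos].
by rewrite integral_std_sin mulr0 addr0.
Qed.

(** Stein's identity for [sin (t * z)]: by the addition formula and oddness the shifted integral is
    [sin (t * h) * C], whose derivative at [h = 0] is [t * C]. *)
Lemma integral_std_sin_mul {R : realType} (t : R) :
  \int[std]_z (sin (t * z) * z) = t * \int[std]_z cos (t * z).
Proof.
set C := \int[std]_z cos (t * z).
have sh := cvg_std_shift (fun z => sin (t * z)) (measurable_sinZ t)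
  (fun z => le1_expR_norm _ _ (norm_sin_le1 (t * z))).
apply: cvg_unique sh _ => //.
have -> : (fun h : R => h^-1 *: (\int[std]_z sin (t * (z + h)) - \int[std]_z sin (t * z)))
    = (fun h => h^-1 *: (sin (t * (h + 0)) * C - sin (t * 0) * C)).
  apply/funext => h; rewrite addr0 mulr0 sin0 mul0r integral_std_sin; congr (_ *: (_ - _)).
  rewrite -integral_std_sin_shift; apply: eq_Rintegral => z _; congr sin; ring.
apply: (is_derive_cvg_quotient (fun h => sin (t * h) * C)).
apply: is_derive_eq.
by rewrite !mulr0 cos0 /GRing.scale/=; ring.
Qed.

(** Differentiation under the integral, dominated by [|z|], followed by Stein's identity: this is
    the differential equation of the characteristic function. *)
Lemma is_derive_std_cos {R : realType} (t : R) :
  is_derive t 1 (fun u : R => \int[std]_z cos (u * z)) (- (t * \int[std]_z cos (t * z))).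
Proof.
pose f (u z : R) : R := cos (u * z).
have df (u z : R) : is_derive u 1 (f ^~ z) (- sin (u * z) * z).
  apply: is_derive_eq.
  by rewrite !scaler0 !scaler1 /GRing.scale/=; ring.
have d1f u z : partial1of2 f u z = - sin (u * z) * z.
  by rewrite partial1of2E; apply: derive_val.
have It : t \in `]t - 1, t + 1[ by rewrite in_itv/= ltrDl ltrBlDr ltrDl ltr01.
have intf (u : R) : (std : probability _ R).-integrable [set: R] (EFin \o f u).
  exact: integrable_std_cos.
have derf (u z : R) : derivable (f ^~ z) u 1 by apply: ex_derive.
have intG : (std : probability _ R).-integrable [set: R] (EFin \o (fun z : R => `|z|)).
  apply: (le_expR_integrable_std 1) => [|z]; first exact: measurableT_comp.
  by rewrite mul1r normr_id norm_le_expR.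
have Gub (u z : R) : `|partial1of2 f u z| <= `|z|.
  by rewrite d1f normrM normrN ler_piMl ?norm_sin_le1.
have D := @derivable_under_integral _ _ _ std f setT measurableT t (t - 1) (t + 1) It
  (fun u _ => intf u) (fun u z _ _ => derf u z) _ (fun z => normr_ge0 z) intG
  (fun u z _ _ => Gub u z).
have E := @differentiation_under_integral _ _ _ std f setT measurableT t (t - 1) (t + 1) It
  (fun u _ => intf u) (fun u z _ _ => derf u z) _ (fun z => normr_ge0 z) intG
  (fun u z _ _ => Gub u z).
apply: DeriveDef => //; rewrite -derive1E E.
rewrite -integral_std_sin_mul -[RHS]mulN1r -RintegralZl//.
  by apply: eq_Rintegral => z _; rewrite d1f mulN1r mulNr.
apply: (le_expR_integrable_std 1) => [|z].
  by apply: measurable_funM => //; exact: measurable_sinZ.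
by rewrite mul1r normrM (le_trans _ (norm_le_expR z))// ler_piMl ?norm_sin_le1.
Qed.

(** By the differential equation [C u * expR (u ^+ 2 / 2)] is constant, and it equals 1 at
    [u = 0]. *)
Lemma integral_std_cos {R : realType} (t : R) :
  \int[std]_z cos (t * z) = expR (- t ^+ 2 / 2).
Proof.
pose C (u : R) : R := \int[std]_z cos (u * z).
have dC (u : R) : is_derive u 1 C (- (u * C u)) by exact: is_derive_std_cos.
have dF (u : R) : is_derive u 1 (fun u => C u * expR (u ^+ 2 / 2)) 0.
  apply: is_derive_eq.
  by rewrite !scaler0 !scaler1 /GRing.scale/=; field.
have := is_derive_0_is_cst t 0 dF.
rewrite expr0n/= mul0r expR0 mulr1 {2}/C.
under eq_Rintegral do rewrite mul0r cos0.
rewrite Rintegral_std_cst mulNr expRN -/(C t) => Ct1.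
by rewrite -[LHS](mulfK (lt0r_neq0 (expR_gt0 (t ^+ 2 / 2)))) Ct1 mul1r.
Qed.

Lemma integral_std_sin_affine {R : realType} (m s : R) :
  \int[std]_z sin (m + s * z) = expR (- s ^+ 2 / 2) * sin m.
Proof.
by under eq_Rintegral do rewrite addrC; rewrite integral_std_sin_shift integral_std_cos mulrC.
Qed.

Lemma integral_std_cos_affine {R : realType} (m s : R) :
  \int[std]_z cos (m + s * z) = expR (- s ^+ 2 / 2) * cos m.
Proof.
by under eq_Rintegral do rewrite addrC; rewrite integral_std_cos_shift integral_std_cos mulrC.
Qed.

(** * Moments of a random variable with a normal law *)

Lemma integrable_EFin_Rintegral {d : measure_display} {T : measurableType d} {R : realType}
    (mu : {measure set T -> \bar R}) (f : T -> R) :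
  mu.-integrable [set: T] (EFin \o f) ->
  (\int[mu]_x (f x)%:E = (\int[mu]_x f x)%:E)%E.
Proof. by move=> fi; rewrite fineK// integrable_fin_num. Qed.

Lemma integral_normal_law {d : measure_display} {T : measurableType d} {R : realType}
    (P : probability T R) (X : T -> R) (m s : R) (f : R -> R) :
  measurable_fun [set: T] X ->
  (forall A, measurable A -> P (X @^-1` A) = normal_law m s A) ->
  measurable_fun [set: R] f ->
  (\int[P]_w (f (X w))%:E = \int[std]_z (f (m + s * z))%:E)%E.
Proof.
move=> mX lX mf; apply: (integral_same_law P std X (fun z => m + s * z) f) => //.
  exact: measurable_affine.
by move=> A mA; exact: etrans (lX A mA) (normal_law_affine m s A mA).
Qed.

Lemma integral_std_affine {R : realType} (m s : R) :
  (\int[std]_z (m + s * z)%:E = m%:E)%E.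
Proof.
have ic : (std : probability _ R).-integrable [set: R] (EFin \o cst m).
  exact: finite_measure_integrable_cst.
have isz : (std : probability _ R).-integrable [set: R] (EFin \o (fun z => s * z)).
  exact: (integrableZl _ _ integrable_std_id).
rewrite integrable_EFin_Rintegral; last exact: (integrableD _ ic isz).
rewrite RintegralD// Rintegral_std_cst RintegralZl//; last exact: integrable_std_id.
by rewrite integral_std_id mulr0 addr0.
Qed.

Lemma integral_std_affine_sqr {R : realType} (m s : R) :
  (\int[std]_z ((m + s * z - m) * (m + s * z - m))%:E = (s ^+ 2)%:E)%E.
Proof.
transitivity (\int[std]_z (s ^+ 2 * (z * z))%:E)%E.
  by apply: eq_integral => z _; congr EFin; ring.
rewrite integrable_EFin_Rintegral; last exact: (integrableZl _ _ integrable_std_sqr).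
by rewrite RintegralZl ?integral_std_sqr ?mulr1//; exact: integrable_std_sqr.
Qed.

Lemma integrable_sqr_Lfun2 {d : measure_display} {T : measurableType d} {R : realType}
    (mu : {measure set T -> \bar R}) (f : T -> R) : measurable_fun [set: T] f ->
  (\int[mu]_x (f x ^+ 2)%:E < +oo)%E -> f \in Lfun mu 2%:E.
Proof.
move=> mf f2; rewrite inE; apply/andP; split; rewrite inE//= /finite_norm unlock.
apply: poweR_lty; rewrite (eq_integral (fun x => (f x ^+ 2)%:E))// => x _.
by rewrite /= powR_mulrn// real_normK// num_real.
Qed.

Section normal_moments.
Context {d : measure_display} {T : measurableType d} {R : realType}.
Context (P : probability T R) (X : T -> R) (m s : R).
Hypothesis mX : measurable_fun [set: T] X.
Hypothesis lX : forall A, measurable A -> P (X @^-1` A) = normal_law m s A.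

(** Normality supplies the square integrability on which the variance and covariance calculus rests.
    The bound is [(m + s * z) ^+ 2 <= 2 * m ^+ 2 + 2 * s ^+ 2 * (z * z)], the difference being
    [(m - s * z) ^+ 2]. *)
Lemma normal_law_Lfun2 : X \in Lfun P 2%:E.
Proof.
apply: integrable_sqr_Lfun2 => //.
rewrite (integral_normal_law P X m s (fun x => x ^+ 2))//.
have i2 : (std : probability _ R).-integrable [set: R]
    (EFin \o (fun z => 2 * m ^+ 2 + 2 * s ^+ 2 * (z * z))).
  have ic : (std : probability _ R).-integrable [set: R] (EFin \o cst (2 * m ^+ 2)).
    exact: finite_measure_integrable_cst.
  have iz := integrableZl measurableT (2 * s ^+ 2) (@integrable_std_sqr R).
  exact: (integrableD _ ic iz).
apply: le_lt_trans (_ : \int[std]_z (2 * m ^+ 2 + 2 * s ^+ 2 * (z * z))%:E < +oo)%E.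
  apply: ge0_le_integral => //.
  - by move=> z _; rewrite lee_fin sqr_ge0.
  - by apply/measurable_EFinP/measurable_funX; exact: measurable_affine.
  - exact: measurable_int i2.
  - move=> z _; rewrite lee_fin -subr_ge0.
    suff -> : 2 * m ^+ 2 + 2 * s ^+ 2 * (z * z) - (m + s * z) ^+ 2 = (m - s * z) ^+ 2.
      exact: sqr_ge0.
    by ring.
by rewrite integrable_EFin_Rintegral ?ltry.
Qed.

Lemma normal_law_expectation : 'E_P[X]%E = m%:E.
Proof.
by rewrite unlock (integral_normal_law P X m s id)// integral_std_affine.
Qed.

Lemma normal_law_variance : 'V_P[X]%E = (s ^+ 2)%:E.
Proof.
rewrite /variance unlock normal_law_expectation/= unlock.
rewrite (integral_normal_law P X m s (fun x => (x - m) * (x - m)))//.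
  by rewrite integral_std_affine_sqr.
by apply: measurable_funM; exact: measurable_funB.
Qed.

Lemma normal_law_sin : \int[P]_w sin (X w) = expR (- s ^+ 2 / 2) * sin m.
Proof.
rewrite -integral_std_sin_affine; congr fine.
by rewrite (integral_normal_law P X m s sin)//; exact: measurable_sin.
Qed.

Lemma normal_law_cos : \int[P]_w cos (X w) = expR (- s ^+ 2 / 2) * cos m.
Proof.
rewrite -integral_std_cos_affine; congr fine.
by rewrite (integral_normal_law P X m s cos)//; exact: measurable_cos.
Qed.

End normal_moments.

(** * Convolution of Gaussian densities *)

Lemma normal_peakM {R : realType} (a b c d : R) : a * b = c * d ->
  normal_peak a * normal_peak b = normal_peak c * normal_peak d.
Proof.
move=> abcd; rewrite /normal_peak -!invfM -!sqrtrM; first last.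
- by rewrite mulrn_wge0// mulr_ge0 ?sqr_ge0 ?pi_ge0.
- by rewrite mulrn_wge0// mulr_ge0 ?sqr_ge0 ?pi_ge0.
congr (Num.sqrt _)^-1.
have E (x y : R) : x ^+ 2 * pi *+ 2 * (y ^+ 2 * pi *+ 2) = (x * y) ^+ 2 * (4 * pi ^+ 2).
  by ring.
by rewrite !E abcd.
Qed.

(* Completing the square in [x]. *)
Lemma normal_pdf_convolution {R : realType} (m a b r x v : R) :
  b != 0 -> r != 0 -> r ^+ 2 = a ^+ 2 + b ^+ 2 ->
  normal_pdf (m + a * x) b v * normal_pdf 0 1 x =
  normal_pdf m r v * normal_pdf (a * (v - m) / r ^+ 2) (b / r) x.
Proof.
move=> b0 r0 r2.
rewrite !normal_pdfE ?oner_neq0 ?mulf_neq0 ?invr_neq0//.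
rewrite mulrACA [RHS]mulrACA; congr (_ * _).
  by apply: normal_peakM; rewrite mulr1 mulrC divfK.
rewrite /normal_fun -!expRD; congr expR.
have r2' : a ^+ 2 + b ^+ 2 != 0 by rewrite -r2 sqrf_eq0.
rewrite exprMn exprVn r2; field; rewrite ?b0 ?r2'//.
Qed.

(** Given the first coordinate [x], the combination has density [normal_pdf (m + a * x) b]. After
    Tonelli, the convolution identity splits the joint density into the claimed density in [v] times
    a normal density in [x] of total mass 1. *)
Lemma std2_lawT {R : realType} (m a b : R) (A : set R) : b != 0 -> measurable A ->
  (std \x std)%E ((fun w : R * R => m + (a * w.1 + b * w.2)) @^-1` A) =
  normal_prob m (Num.sqrt (a ^+ 2 + b ^+ 2)) A.
Proof.
move=> b0 mA; set r := Num.sqrt _.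
have ab_gt0 : 0 < a ^+ 2 + b ^+ 2.
  by rewrite ltr_wpDl ?sqr_ge0// lt_neqAle sqr_ge0 andbT eq_sym sqrf_eq0.
have r0 : r != 0 by rewrite gt_eqF// sqrtr_gt0.
have r2 : r ^+ 2 = a ^+ 2 + b ^+ 2 by rewrite sqr_sqrtr// ltW.
pose f (w : R * R) : \bar R := ((normal_pdf (m + a * w.1) b w.2)%:E * (\1_A w.2)%:E)%E.
have f0 w : (0 <= f w)%E by rewrite mule_ge0// lee_fin normal_pdf_ge0.
have mf : measurable_fun [set: R * R] f.
  apply: emeasurable_funM; apply/measurable_EFinP; last first.
    by apply: (measurableT_comp (f := \1_A : R -> R)).
  (* Recentring moves the dependence on [w.1] from the mean into the argument, which makes joint
     measurability a matter of composition. *)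
  rewrite (_ : (fun w => _) = fun w : R * R => normal_pdf 0 b (w.2 - (m + a * w.1))).
    apply: (measurableT_comp (measurable_normal_pdf 0 b)).
    apply: measurable_funB => //; apply: measurable_funD => //.
    exact: measurable_funM.
  by apply/funext => w; rewrite !normal_pdfE// normal_fun_center.
transitivity (\int[std]_x \int[lebesgue_measure]_v f (x, v))%E.
  rewrite /product_measure1; apply: eq_integral => x _ /=.
  rewrite xsectionE/=.
  transitivity (normal_prob (m + a * x) b A).
    rewrite (normal_prob_affine (m + a * x) b A b0 mA).
    by congr (std _); apply/seteqP; split => y /=; rewrite addrA.
  rewrite /normal_prob integral_mkcond.
  by apply: eq_integral => v _; rewrite epatch_indic.
rewrite (fubini_tonelli (m1 := std) (m2 := lebesgue_measure) f mf f0).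
rewrite /normal_prob [RHS]integral_mkcond; apply: eq_integral => v _.
rewrite ge0_integral_normal_prob//; last first.
  exact: (measurableT_comp mf).
transitivity (\int[lebesgue_measure]_x ((normal_pdf m r v * \1_A v)%:E *
   (normal_pdf (a * (v - m) / r ^+ 2) (b / r) x)%:E))%E.
  apply: eq_integral => x _; rewrite /f/= -!EFinM mulrAC (normal_pdf_convolution _ _ _ r)//.
  by congr EFin; ring.
rewrite ge0_integralZl//; last 3 first.
- by apply/measurable_EFinP; exact: measurable_normal_pdf.
- by move=> x _; rewrite lee_fin normal_pdf_ge0.
- by rewrite lee_fin mulr_ge0 ?normal_pdf_ge0.
by rewrite integral_normal_pdf mule1 epatch_indic.
Qed.

(** When [b = 0] the second coordinate integrates out and leaves the image under [m + a * z];
    symmetry replaces [a] by [|a|], the square root of [a ^+ 2]. *)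
Lemma std2_law {R : realType} (m a b : R) (A : set R) : measurable A ->
  (std \x std)%E ((fun w : R * R => m + (a * w.1 + b * w.2)) @^-1` A) =
  normal_law m (Num.sqrt (a ^+ 2 + b ^+ 2)) A.
Proof.
move=> mA; have [->|b0] := eqVneq b 0; last first.
  rewrite std2_lawT// /normal_law gt_eqF//.
  by rewrite sqrtr_gt0 ltr_wpDl ?sqr_ge0// lt_neqAle sqr_ge0 andbT eq_sym sqrf_eq0.
rewrite expr0n/= addr0 sqrtr_sqr normal_law_affine//.
have mp (s : R) : measurable ((fun z : R => m + s * z) @^-1` A).
  by rewrite -[X in measurable X]setTI; exact: measurable_affine.
transitivity (std ((fun z : R => m + a * z) @^-1` A)).
  transitivity ((std \x std)%E (((fun z : R => m + a * z) @^-1` A) `*` [set: R])).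
    congr ((std \x std)%E _).
    by apply/seteqP; split => -[x y] /=; rewrite mul0r addr0// => -[].
  rewrite product_measure1E//; last exact: mp.
  by rewrite [X in (_ * X)%E]probability_setT mule1.
have [a0|a0] := leP 0 a; first by rewrite ger0_norm.
rewrite ltr0_norm// -(std_opp _ (mp _)); congr (std _).
by apply/seteqP; split => z /=; rewrite mulrN mulNr.
Qed.

(** * Existence of normal pairs with a prescribed covariance matrix *)

Lemma psd_covmx2 {R : realType} (nu11 nu22 nu12 : R) :
  psdmx (covmx2 nu11 nu22 nu12) ->
  forall x y : R, 0 <= x ^+ 2 * nu11 + 2 * (x * y) * nu12 + y ^+ 2 * nu22.
Proof.
move=> [_ psd] x y; have := psd (\col_(i < 2) (if i == ord0 then x else y)).
rewrite !mxE !big_ord_recl big_ord0 /= !mxE !big_ord_recl !big_ord0 /= !mxE /=.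
by rewrite !addr0 => /le_trans; apply; rewrite le_eqVlt; apply/orP; left; apply/eqP; ring.
Qed.

(** Cholesky factorization: [s], [a], [b] are the entries of a lower triangular factor with rows
    [(s, 0)] and [(a, b)]. *)
Lemma psd_covmx2_factor {R : realType} (nu11 nu22 nu12 : R) :
  psdmx (covmx2 nu11 nu22 nu12) ->
  exists s a b : R, [/\ s ^+ 2 = nu11, s * a = nu12 & a ^+ 2 + b ^+ 2 = nu22].
Proof.
move=> /psd_covmx2 psd.
have nu11_ge0 : 0 <= nu11 by have := psd 1 0; rewrite expr1n expr0n/=; lra.
have nu22_ge0 : 0 <= nu22 by have := psd 0 1; rewrite expr1n expr0n/=; lra.
have [nu11_0|nu11_neq0] := eqVneq nu11 0.
  exists 0, 0, (Num.sqrt nu22); rewrite nu11_0 !expr0n/= mul0r add0r sqr_sqrtr//; split => //.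
  (* At this vector the form equals [- (nu22 + 2) * nu12 ^+ 2], which forces [nu12 = 0]. *)
  have := psd (- (nu22 + 1)) nu12; rewrite nu11_0.
  have := sqr_ge0 nu12; rewrite !expr2 => h1 h2.
  have : nu12 * nu12 = 0 by nra.
  by move/eqP; rewrite mulf_eq0 orbb => /eqP.
have nu11_gt0 : 0 < nu11 by rewrite lt_neqAle eq_sym nu11_neq0.
have s0 : Num.sqrt nu11 != 0 by rewrite gt_eqF// sqrtr_gt0.
have ss : Num.sqrt nu11 ^+ 2 = nu11 by rewrite sqr_sqrtr.
(* The Schur complement is the value of the form at [(- nu12 / nu11, 1)]. *)
have D_ge0 : 0 <= nu22 - nu12 ^+ 2 / nu11.
  have -> : nu22 - nu12 ^+ 2 / nu11 = (- nu12 / nu11) ^+ 2 * nu11 +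
      2 * (- nu12 / nu11 * 1) * nu12 + 1 ^+ 2 * nu22 by field.
  exact: psd.
exists (Num.sqrt nu11), (nu12 / Num.sqrt nu11), (Num.sqrt (nu22 - nu12 ^+ 2 / nu11)).
split => //; first by rewrite mulrC divfK.
by rewrite (sqr_sqrtr D_ge0) exprMn exprVn ss addrC subrK.
Qed.

Lemma normal_pair_exists {R : realType} (mu1 nu11 nu22 nu12 : R) :
  psdmx (covmx2 nu11 nu22 nu12) ->
  exists (d : measure_display) (T : measurableType d) (P : probability T R)
    (X1 X2 : {RV P >-> R}), normal_pair mu1 nu11 nu22 nu12 X1 X2.
Proof.
move=> /psd_covmx2_factor[s [a [b [s2 sa ab]]]].
pose P : probability (measurableTypeR R * measurableTypeR R)%type R := (std \x std)%E.
pose X (m a b : R) (w : measurableTypeR R * measurableTypeR R) : R := m + (a * w.1 + b * w.2).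
have mX m a' b' : measurable_fun [set: measurableTypeR R * measurableTypeR R] (X m a' b').
  by apply: measurable_funD => //; apply: measurable_funD; apply: measurable_funM.
pose X1 : {RV P >-> R} := HB.pack (X mu1 s 0) (isMeasurableFun.Build _ _ _ _ _ (mX mu1 s 0)).
pose X2 : {RV P >-> R} := HB.pack (X 0 a b) (isMeasurableFun.Build _ _ _ _ _ (mX 0 a b)).
have law m a' b' A : measurable A ->
    P (X m a' b' @^-1` A) = normal_law m (Num.sqrt (a' ^+ 2 + b' ^+ 2)) A.
  exact: std2_law.
have var m a' b' : 'V_P[X m a' b']%E = (a' ^+ 2 + b' ^+ 2)%:E.
  rewrite (normal_law_variance P _ _ _ (mX m a' b') (law m a' b')).
  by rewrite sqr_sqrtr// addr_ge0 ?sqr_ge0.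
have L2 m a' b' : X m a' b' \in Lfun P 2%:E.
  exact: normal_law_Lfun2 (mX m a' b') (law m a' b').
exists _, (measurableTypeR R * measurableTypeR R)%type, P, X1, X2; split.
- move=> u v; exists (u * mu1), (Num.sqrt ((u * s + v * a) ^+ 2 + (v * b) ^+ 2)).
  split=> [|A mA]; first exact: sqrtr_ge0.
  transitivity (P (X (u * mu1) (u * s + v * a) (v * b) @^-1` A)); last exact: law.
  congr (P _); apply/seteqP.
  have E (w : R * R) : u * X1 w + v * X2 w = X (u * mu1) (u * s + v * a) (v * b) w.
    by rewrite /= /X; ring.
  by split => w /=; rewrite E.
- exact: normal_law_expectation (mX mu1 s 0) (law mu1 s 0).
- by rewrite var expr0n addr0 s2.
- by rewrite var ab.
(* Polarization: the sum has again the form [X], so its variance is known and the covariance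
   follows. Finiteness of the covariance permits solving for it in the extended reals. *)
have XD : X mu1 s 0 \+ X 0 a b = X mu1 (s + a) b.
  by apply/funext => w; rewrite /X/=; ring.
have := varianceD (L2 mu1 s 0) (L2 0 a b); rewrite XD !var.
have := covariance_fin_num (Lfun_subset12 _ (L2 mu1 s 0)) (Lfun_subset12 _ (L2 0 a b))
  (Lfun2_mul_Lfun1 (L2 mu1 s 0) (L2 0 a b)).
rewrite fin_num_measure// => /(_ isT isT) cfin.
rewrite -[covariance P X1 X2]/(covariance P (X mu1 s 0) (X 0 a b)).
rewrite -(fineK cfin) -EFinM -!EFinD => -[E]; congr EFin.
move: E; rewrite sqrrD -mulr_natl sa expr0n/= addr0; lra.
Qed.

(** * The covariance of the sine of one variable with the other *)

Lemma jointly_normal_Lfun2 {d : measure_display} {T : measurableType d} {R : realType}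
    (P : probability T R) (X1 X2 : {RV P >-> R}) : jointly_normal X1 X2 ->
  (X1 : T -> R) \in Lfun P 2%:E /\ (X2 : T -> R) \in Lfun P 2%:E.
Proof.
move=> jn; split.
- have [m [s [_ law]]] := jn 1 0.
  have E : (fun w => 1 * X1 w + 0 * X2 w) = X1 :> (T -> R).
    by apply/funext => w; rewrite mul1r mul0r addr0.
  by rewrite E in law; exact: normal_law_Lfun2 law.
- have [m [s [_ law]]] := jn 0 1.
  have E : (fun w => 0 * X1 w + 1 * X2 w) = X2 :> (T -> R).
    by apply/funext => w; rewrite mul1r mul0r add0r.
  by rewrite E in law; exact: normal_law_Lfun2 law.
Qed.

(** Joint normality gives some parameters; expectation and variance, computed by linearity and
    bilinearity, identify them. Only [s ^+ 2] is recorded, as this is how [s] enters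
    [normal_law_sin] and [normal_law_cos]. *)
Lemma normal_pair_line {d : measure_display} {T : measurableType d} {R : realType}
    (P : probability T R) (mu1 nu11 nu22 nu12 : R) (X1 X2 : {RV P >-> R}) (t : R) :
  normal_pair mu1 nu11 nu22 nu12 X1 X2 ->
  exists s : R, s ^+ 2 = nu11 + 2 * t * nu12 + t ^+ 2 * nu22 /\
    forall A, measurable A -> P ((fun w => X1 w + t * X2 w) @^-1` A) =
      normal_law (mu1 + t * fine 'E_P[X2]%E) s A.
Proof.
move=> [jn e1 v1 v2 c12]; have [L1 L2] := jointly_normal_Lfun2 P X1 X2 jn.
have Pfin : P setT \is a fin_num := fin_num_measure P _ measurableT.
have I1 := Lfun_subset12 Pfin L1; have I2 := Lfun_subset12 Pfin L2.
have [m [s [_ law]]] := jn 1 t.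
have E : (fun w => 1 * X1 w + t * X2 w) = (fun w => X1 w + t * X2 w) :> (T -> R).
  by apply/funext => w; rewrite mul1r.
rewrite {}E in law.
have mX : measurable_fun [set: T] (fun w => X1 w + t * X2 w).
  by apply: measurable_funD => //; exact: measurable_funM.
have XD : (fun w => X1 w + t * X2 w) = X1 \+ (t \o* X2).
  by apply/funext => w /=; rewrite mulrC.
have Lt : (t \o* X2 : T -> R) \in Lfun P 2%:E by rewrite Lfun_scale// ler1n.
have em := normal_law_expectation P _ _ _ mX law.
have vs := normal_law_variance P _ _ _ mX law.
rewrite XD expectationD// in em; last exact: Lfun_subset12.
rewrite expectationZl// e1 -(fineK (expectation_fin_num I2)) in em.
have {}em : m = mu1 + t * fine 'E_P[X2]%E by move: em; rewrite -EFinM -EFinD => -[].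
rewrite XD varianceD// varianceZ// v1 v2 covarianceZr// ?c12 in vs; last first.
  exact: Lfun2_mul_Lfun1.
exists s; split; last by rewrite -em.
by move: vs; rewrite -!EFinM -!EFinD => -[<-]; ring.
Qed.

Lemma normal_pair_cov_sin {d : measure_display} {T : measurableType d} {R : realType}
    (P : probability T R) (mu1 nu11 nu22 nu12 : R) (X1 X2 : {RV P >-> R}) :
  normal_pair mu1 nu11 nu22 nu12 X1 X2 ->
  covariance P ((fun x : R => sin x) \o X1) X2 =
  (nu12 * expR (- nu11 / 2) * cos mu1)%:E.
Proof.
move=> np; have [jn e1 v1 v2 c12] := np.
have [L1 L2] := jointly_normal_Lfun2 P X1 X2 jn.
have Pfin : P setT \is a fin_num := fin_num_measure P _ measurableT.
have I2 := Lfun_subset12 Pfin L2.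
set mu2 := fine 'E_P[X2]%E.
have mline (t : R) : measurable_fun [set: T] (fun w => X1 w + t * X2 w).
  by apply: measurable_funD => //; exact: measurable_funM.
have iX2 : P.-integrable [set: T] (EFin \o X2) by exact/Lfun1_integrable.
pose f (t : R) (w : T) : R := cos (X1 w + t * X2 w).
have mf t : measurable_fun [set: T] (f t) by exact: measurableT_comp measurable_cos _.
have df (t : R) w : is_derive t 1 (f ^~ w) (- sin (X1 w + t * X2 w) * X2 w).
  apply: is_derive_eq.
  by rewrite !scaler0 !scaler1 /GRing.scale/=; ring.
have d1f t w : partial1of2 f t w = - sin (X1 w + t * X2 w) * X2 w.
  by rewrite partial1of2E; apply: derive_val.
have F t : \int[P]_w f t w =
    expR (- (nu11 + 2 * t * nu12 + t ^+ 2 * nu22) / 2) * cos (mu1 + t * mu2).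
  have [s [<- law]] := normal_pair_line P _ _ _ _ X1 X2 t np.
  exact: normal_law_cos (mline t) law.
have EsinX1 : \int[P]_w sin (X1 w) = expR (- nu11 / 2) * sin mu1.
  have [s [s2 law]] := normal_pair_line P _ _ _ _ X1 X2 0 np.
  transitivity (\int[P]_w sin (X1 w + 0 * X2 w)).
    by apply: eq_Rintegral => w _; rewrite mul0r addr0.
  rewrite (normal_law_sin P _ _ _ (mline 0) law) s2.
  by rewrite mulr0 !mul0r !addr0 expr0n/= mul0r addr0.
have bd_int (g : R -> R) : measurable_fun [set: R] g -> (forall x, `|g x| <= 1) ->
    P.-integrable [set: T] (EFin \o (g \o X1)).
  move=> mg g1; apply: measurable_bounded_integrable => //.
  - by rewrite ltey_eq Pfin.
  - exact: measurableT_comp.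
  - by exists 1; split=> // x x1 w _; exact: le_trans (g1 _) (ltW x1).
have isX : P.-integrable [set: T] (EFin \o (fun w => sin (X1 w) * X2 w)).
  apply: le_integrable iX2 => //.
    by apply/measurable_EFinP/measurable_funM => //; exact: measurableT_comp measurable_sin _.
  by move=> w _; rewrite /= lee_fin normrM ler_piMl// norm_sin_le1.
(* The derivative at 0 of the integral of [f t] is computed twice: under the integral sign,
   dominated by [|X2|], and from the closed form [H]. *)
have key : \int[P]_w (sin (X1 w) * X2 w) =
    expR (- nu11 / 2) * (sin mu1 * mu2 + nu12 * cos mu1).
  have I0 : (0:R) \in `]-1, 1[ by rewrite in_itv/= ltrN10 ltr01.
  have intf (t : R) : P.-integrable [set: T] (EFin \o f t).
    apply: measurable_bounded_integrable => //.
    - by rewrite ltey_eq Pfin.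
    - by exists 1; split=> // x x1 w _; exact: le_trans (norm_cos_le1 _) (ltW x1).
  have derf (t : R) w : derivable (f ^~ w) t 1 by apply: ex_derive.
  have intG := integrable_norm iX2.
  have Gub t w : `|partial1of2 f t w| <= `|X2 w|.
    by rewrite d1f normrM normrN ler_piMl ?norm_sin_le1.
  have D := @cvg_differentiation_under_integral _ _ _ P f setT measurableT 0 (-1) 1 I0
    (fun t _ => intf t) (fun t w _ _ => derf t w) _ (fun w => normr_ge0 (X2 w)) intG
    (fun t w _ _ => Gub t w).
  pose H (t : R) : R :=
    expR (- (nu11 + 2 * t * nu12 + t ^+ 2 * nu22) / 2) * cos (mu1 + t * mu2).
  have dH : is_derive (0:R) (1:R) H (- (expR (- nu11 / 2) * (sin mu1 * mu2 + nu12 * cos mu1))).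
    apply: is_derive_eq.
    rewrite !mulr0 !mul0r !addr0 !expr0n/= !mul0r !addr0 !scaler0 !scaler1 /GRing.scale/=.
    by field.
  have D' := is_derive_cvg_quotient _ _ _ dH.
  have E : (fun h : R => h^-1 *: (\int[P]_w f (h + 0) w - \int[P]_w f 0 w)) =
      (fun h => h^-1 *: (H (h + 0) - H 0)) by apply/funext => h; rewrite !F.
  rewrite E in D.
  have EQ : \int[P]_w partial1of2 f 0 w =
      - (expR (- nu11 / 2) * (sin mu1 * mu2 + nu12 * cos mu1)).
    by apply: cvg_unique D D'.
  apply: oppr_inj; rewrite -EQ -mulN1r -RintegralZl//.
  apply: eq_Rintegral => w _; rewrite d1f mul0r addr0; ring.
have Ls : ((fun x : R => sin x) \o X1) \in Lfun P 1.
  by apply/Lfun1_integrable; apply: bd_int; [exact: measurable_sin|exact: norm_sin_le1].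
have LsX : (((fun x : R => sin x) \o X1) * X2) \in Lfun P 1 by exact/Lfun1_integrable.
rewrite covarianceE//.
have -> : 'E_P[((fun x : R => sin x) \o X1) * X2]%E =
    (expR (- nu11 / 2) * (sin mu1 * mu2 + nu12 * cos mu1))%:E.
  by rewrite unlock -key -integrable_EFin_Rintegral.
have -> : 'E_P[(fun x : R => sin x) \o X1]%E = (expR (- nu11 / 2) * sin mu1)%:E.
  rewrite unlock -EsinX1 -integrable_EFin_Rintegral//.
  by apply: bd_int; [exact: measurable_sin|exact: norm_sin_le1].
(* The term with [sin mu1 * mu2] cancels against the product of expectations, so the mean of [X2]
   disappears. *)
rewrite -(fineK (expectation_fin_num I2)) -/mu2 -EFinM -EFinB; congr EFin; ring.
Qed.

Theorem lemmaG3 (R : realType) (mu1 nu11 nu22 nu12 : R)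
    (hpsd : psdmx (covmx2 nu11 nu22 nu12)) :
  Lcov (fun x : R => sin x) mu1 nu11 nu22 nu12
  = (nu12 * expR (- nu11 / 2) * cos mu1)%:E.
Proof.
have ex := normal_pair_exists mu1 nu11 nu22 nu12 hpsd.
apply: xget_unique => [|l [_ covl]].
  by split=> // d T P X1 X2; exact: normal_pair_cov_sin.
(* Existence also gives uniqueness: any admissible [l] is the covariance of this particular pair. *)
have [d [T [P [X1 [X2 np]]]]] := ex.
by rewrite -(covl d T P X1 X2 np); apply: normal_pair_cov_sin np.
Qed.
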